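(* Let $d\ge1$ be fixed, and let $R$ and $B$ be finite point sets in $\mathbb{R}^d$ with $|R|=n$, $|B|=m$ and $n\ge m$. Let $T^R$ and $T^B$ be $d$-dimensional range trees built on $R$ and $B$, respectively, where each layer consists of weight-balanced \textsc{bb}[$\alpha$] trees (for a fixed constant $\alpha$). Then the number of links between $T^R$ and $T^B$ is $O(n(\log n\log\log n)^{d-1})$.
   Context: A $d$-dimensional range tree on a point set $S$: the first layer is a binary search tree on the first coordinate storing $S$ in its leaves; each node $u$ of a layer-$i$ tree ($i<d$) has an associated layer-$(i+1)$ tree built on its canonical subset $P_u$ (the points in the leaves of the subtree of $u$), keyed on coordinate $i+1$. Nodes of layer-$d$ trees are the lowest-layer nodes. For a lowest-layer node $w$, let $u_1,\dots,u_d=w$ be the chain with $u_1$ in the first-layer tree and $u_{i+1}$ a node of the tree associated with $u_i$. For a tree $T$ storing a set $S$ of reals and an interval $I$, $C(T,I)$ is the minimal set of nodes whose canonical subsets together represent exactly $S\cap I$. For $x\in\mathbb{R}^d$, the canonical nodes $C^B(x)$ of $T^B$ are the lowest-layer nodes $w$ with chain $u_1,\dots,u_d$ such that $u_1\in C(\text{top tree},[x_1,\infty))$ and $u_{i+1}\in C(T_{u_i},[x_{i+1},\infty))$ for all $i$ (these represent the points of $B$ dominating $x$); $C^R(y)$ for $T^R$ is defined analogously with intervals $(-\infty,y_i]$. For a lowest-layer node $u$ of $T^R$ with chain $u_1,\dots,u_d$ set $\overline{m}^u=(\max_{p\in P_{u_1}}p_1,\dots,\max_{p\in P_{u_d}}p_d)$,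 and for a lowest-layer node $v$ of $T^B$ with chain $v_1,\dots,v_d$ set $\underline{m}^v=(\min_{p\in P_{v_1}}p_1,\dots,\min_{p\in P_{v_d}}p_d)$. Lowest-layer nodes $u\in T^R$ and $v\in T^B$ are linked if and only if $v\in C^B(\overline{m}^u)$ and $u\in C^R(\underline{m}^v)$. The constant in the $O$-bound may depend on $d$ and $\alpha$. *)

(* Defs.v *)
From HB Require Import structures.
From mathcomp Require Import all_boot all_order all_algebra.
From mathcomp Require Import finmap.
From mathcomp Require Import boolp reals exp.

Set Implicit Arguments.
Unset Strict Implicit.
Unset Printing Implicit Defensive.

Import Order.TTheory GRing.Theory Num.Theory.
Local Open Scope ring_scope.

(* A node is identified with its address: the sequence of turns leading to it
   from the root, [false] for left and [true] for right. *)
Definition address := seq bool.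

Section RangeTree.
Variables (R : realType) (d : nat).
Local Notation point := 'rV[R]_d.

(* Leaf-oriented binary trees; every node, leaf or internal, carries a label
   in [A], which will be its associated structure. *)
Inductive bintree (A : Type) : Type :=
| Leaf of point & A
| Node of A & bintree A & bintree A.

Section BinTree.
Variable A : Type.
Implicit Types (t : bintree A) (c : 'I_d) (I : interval R).

Fixpoint leaves t : seq point :=
  match t with
  | Leaf p _ => [:: p]
  | Node _ l r => leaves l ++ leaves r
  end.

Definition label t : A := match t with Leaf _ a => a | Node a _ _ => a end.

Fixpoint nodes t : seq address :=
  match t with
  | Leaf _ _ => [:: [::]]
  | Node _ l r =>
      [::] :: [seq false :: u | u <- nodes l] ++ [seq true :: u | u <- nodes r]
  end.

(* Only meaningful for [u \in nodes t]. *)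
Fixpoint subtree t (u : address) : bintree A :=
  match t, u with
  | Node _ l r, b :: u' => subtree (if b then r else l) u'
  | _, _ => t
  end.

Definition canonical_subset t u : seq point := leaves (subtree t u).

Fixpoint search_tree c t : bool :=
  match t with
  | Leaf _ _ => true
  | Node _ l r =>
      [&& allrel (fun p q : point => p 0 c <= q 0 c) (leaves l) (leaves r),
          search_tree c l & search_tree c r]
  end.

(* The weight of a node is its number of leaves, i.e. one more than the number
   of internal nodes below it. *)
Definition weight t : R := (size (leaves t))%:R.

Fixpoint bb_tree (alpha : R) t : bool :=
  match t with
  | Leaf _ _ => true
  | Node _ l r =>
      [&& alpha * weight t <= weight l, alpha * weight t <= weight r,
          bb_tree alpha l & bb_tree alpha r]
  end.

Definition represents t c I (C : {fset address}) : Prop :=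
  {subset C <= nodes t} /\
  forall p : point,
    (exists2 u, u \in C & p \in canonical_subset t u) <->
    (p \in leaves t) && (p 0 c \in I).

(* C(t, I), for the keys of coordinate [c]. Minimality is with respect to
   cardinality (all the leaves with key in [I] would already be minimal for
   inclusion); the smallest representing set is unique. *)
Definition is_canonical_set t c I (C : {fset address}) : Prop :=
  represents t c I C /\
  forall C' : {fset address}, represents t c I C' -> (#|` C| <= #|` C'|)%N.

Definition in_canonical_set t c I (u : address) : Prop :=
  exists2 C : {fset address}, is_canonical_set t c I C & u \in C.

End BinTree.

(* Multi-layer trees whose successive layers are keyed on the coordinates
   listed in [cs]; the label of a node is its associated tree in the next
   layer, and a dummy [tt] in the lowest layer. *)
Fixpoint layers (cs : seq 'I_d) : Type :=
  if cs is _ :: cs' then bintree (layers cs') else unit.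

Fixpoint is_layers (alpha : R) (cs : seq 'I_d) :
    seq point -> layers cs -> Prop :=
  match cs return seq point -> layers cs -> Prop with
  | [::] => fun _ _ => True
  | c :: cs' => fun S t =>
      [/\ perm_eq (leaves t) S, search_tree c t, bb_tree alpha t &
          forall u, u \in nodes t ->
            is_layers alpha (canonical_subset t u) (label (subtree t u))]
  end.

(* A lowest-layer node [w] is identified with its chain [u_1; ...; u_d = w],
   [u_(i.+1)] being an address in the tree associated with [u_i]. *)
Definition chain := seq address.

Fixpoint lowest_nodes (cs : seq 'I_d) : layers cs -> seq chain :=
  match cs return layers cs -> seq chain with
  | [::] => fun _ => [:: [::]]
  | c :: cs' => fun t =>
      [seq u :: w | u <- nodes t, w <- lowest_nodes (label (subtree t u))]
  end.

Fixpoint in_canonical_nodes (I : 'I_d -> interval R) (cs : seq 'I_d) :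
    layers cs -> chain -> Prop :=
  match cs return layers cs -> chain -> Prop with
  | [::] => fun _ w => w = [::]
  | c :: cs' => fun t w =>
      if w is u :: w' then
        in_canonical_set t c (I c) u /\
        in_canonical_nodes I (label (subtree t u)) w'
      else False
  end.

(* The canonical subset of the node of the chain [w] that lies in the layer
   keyed on coordinate [c]. *)
Fixpoint chain_subset (c : 'I_d) (cs : seq 'I_d) :
    layers cs -> chain -> seq point :=
  match cs return layers cs -> chain -> seq point with
  | [::] => fun _ _ => [::]
  | c' :: cs' => fun t w =>
      if w is u :: w' then
        if c == c' then canonical_subset t u
        else chain_subset c (label (subtree t u)) w'
      else [::]
  end.

(* Maximum and minimum of a nonempty sequence. *)
Definition max_seq (s : seq R) : R := \big[Num.max/head 0 s]_(x <- s) x.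
Definition min_seq (s : seq R) : R := \big[Num.min/head 0 s]_(x <- s) x.

Definition upper_corner cs (t : layers cs) (w : chain) : point :=
  \row_c max_seq [seq p 0 c | p : point <- chain_subset c t w].

Definition lower_corner cs (t : layers cs) (w : chain) : point :=
  \row_c min_seq [seq p 0 c | p : point <- chain_subset c t w].

Definition in_CB cs (tB : layers cs) (x : point) (v : chain) : Prop :=
  in_canonical_nodes (fun c => `[x 0 c, +oo[) tB v.

Definition in_CR cs (tR : layers cs) (y : point) (u : chain) : Prop :=
  in_canonical_nodes (fun c => `]-oo, y 0 c]) tR u.

Definition linked cs (tR tB : layers cs) (u v : chain) : Prop :=
  in_CB tB (upper_corner tR u) v /\ in_CR tR (lower_corner tB v) u.

(* [None] is the tree on the empty set, which has no nodes. *)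
Definition range_tree : Type := option (layers (enum 'I_d)).

Definition is_range_tree (alpha : R) (S : {fset point}) (T : range_tree) :
    Prop :=
  if T is Some t then is_layers alpha S t else S = fset0.

Definition links (TR TB : range_tree) : {fset chain * chain} :=
  match TR, TB with
  | Some tR, Some tB =>
      [fset uv in [seq (u, v) | u <- lowest_nodes tR, v <- lowest_nodes tB]
         | `[< linked tR tB uv.1 uv.2 >]]%fset
  | _, _ => fset0
  end.

End RangeTree.

(* Main.v *)
Require Import Defs.
From HB Require Import structures.
From mathcomp Require Import all_boot all_order all_algebra.
From mathcomp Require Import finmap.
From mathcomp Require Import boolp reals sequences exp.
From mathcomp Require Import ring lra.

(* The nodes of a balanced tree that are canonical for a one-sided interval
   hang off a single root-to-leaf path, so their weights decrease geometrically:
   those of weight in [a, b] number O(1 + log (b / a)), and those of weight at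
   most b have total weight O(b).  Write L_e(a, b) for the number of links
   between two e-dimensional trees on a and b points; it is at most the sum of
   L_(e-1)(|u|, |v|) over the linked pairs (u, v) of first-layer nodes.
   - Crudely, L_e(a, b) <= min(a, b) * polylog.
   - L_1(a, b) = O(a + b): a node u of weight w is linked to O(1 + log w) nodes
     that are not heavier, and the sum of 1 + log |u| over a tree is linear.
   - For e > 1 split the pairs according to whether |u| and |v| are within a
     polylogarithmic factor D of each other.  Each u has O(log log n) such near
     partners, for each of which L_(e-1) is bounded inductively.  For far pairs
     the crude bound is used: the lighter partners of v have total weight
     O(|v| / D), which absorbs the polylog. *)

Set Implicit Arguments.
Unset Strict Implicit.
Unset Printing Implicit Defensive.

Import Order.TTheory GRing.Theory Num.Theory.
Local Open Scope ring_scope.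

(** * Canonical nodes of a predicate that cuts a tree along one path *)

Section Cuts.
Variables (R : realType) (d : nat) (A : Type).
Local Notation point := 'rV[R]_d.
Implicit Types (P : pred point) (t l r : bintree R d A) (u v : address).

Definition node_weight t v : R := weight (subtree t v).

Lemma size_leaves_gt0 t : (0 < size (leaves t))%N.
Proof. by elim: t => //= a l IHl r _; rewrite size_cat addn_gt0 IHl. Qed.

Lemma weight_ge1 t : 1 <= weight t.
Proof. by rewrite /weight ler1n size_leaves_gt0. Qed.

Lemma weight_gt0 t : 0 < weight t.
Proof. exact: lt_le_trans ltr01 (weight_ge1 t). Qed.

Lemma weight_node a l r : weight (Node a l r) = weight l + weight r.
Proof. by rewrite /weight /= size_cat natrD. Qed.

Lemma has_all_leaves P t : all P (leaves t) -> has P (leaves t).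
Proof.
case: (leaves t) (size_leaves_gt0 t) => //= p s _.
by move=> /andP[->].
Qed.

(* The nodes all of whose leaves satisfy [P], and which are maximal as such. *)
Fixpoint canonical_node P t v : bool :=
  if all P (leaves t) then v == [::] else
  match t, v with
  | Node _ l r, b :: v' => canonical_node P (if b then r else l) v'
  | _, _ => false
  end.

Definition homogeneous P (s : seq point) := all P s || ~~ has P s.

(* [P] is constant on the leaves below every node off some root-to-leaf path,
   as is membership in a one-sided interval of keys. *)
Fixpoint single_cut P t : bool :=
  match t with
  | Leaf _ _ => true
  | Node _ l r =>
      [&& homogeneous P (leaves l) || homogeneous P (leaves r),
          single_cut P l & single_cut P r]
  end.

(** Taking [f] constantly 1 or the identity gives the number or the total weight of the canonical
    nodes, with [Q] selecting a range of weights. *)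
Definition canon_sum P t (Q : pred R) (f : R -> R) : R :=
  \sum_(v <- nodes t | canonical_node P t v && Q (node_weight t v))
    f (node_weight t v).

Lemma big_nodes_node (F : address -> R) (Q : pred address) a l r :
  \sum_(v <- nodes (Node a l r) | Q v) F v =
  (if Q [::] then F [::] else 0) +
  (\sum_(v <- nodes l | Q (false :: v)) F (false :: v) +
   \sum_(v <- nodes r | Q (true :: v)) F (true :: v)).
Proof.
by rewrite /= big_cons big_cat /= !big_map; case: ifP => // _; rewrite add0r.
Qed.

Lemma canon_sum_full P t Q f : all P (leaves t) ->
  canon_sum P t Q f = if Q (weight t) then f (weight t) else 0.
Proof.
rewrite /canon_sum; case: t => [p a|a l r] fullt.
  by rewrite /= big_cons big_nil /= -[_ && true]/(all P (leaves (Leaf p a))) fullt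
             /= addr0.
rewrite big_nodes_node /= -[all P (_ ++ _)]/(all P (leaves (Node a l r))) fullt /=.
by rewrite !big_pred0_eq !addr0.
Qed.

Lemma canon_sum_node P a l r Q f : ~~ all P (leaves (Node a l r)) ->
  canon_sum P (Node a l r) Q f = canon_sum P l Q f + canon_sum P r Q f.
Proof.
move=> /negPf nfull; rewrite /canon_sum big_nodes_node /=.
by rewrite -[all P (_ ++ _)]/(all P (leaves (Node a l r))) nfull /= add0r.
Qed.

Lemma canon_sum_empty P t Q f : ~~ has P (leaves t) -> canon_sum P t Q f = 0.
Proof.
elim: t => [p a|a l IHl r IHr].
  by move=> /=; rewrite orbF => /negPf nP; rewrite /canon_sum big_cons big_nil /= nP.
move=> nP; have := nP; rewrite /= has_cat negb_or => /andP[nl nr].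
have nfull : ~~ all P (leaves (Node a l r)).
  by apply: contraNN nP; apply: has_all_leaves.
by rewrite canon_sum_node // IHl // IHr // addr0.
Qed.

(** Below a homogeneous node, only that node itself can be canonical. *)
Lemma canon_sum_homogeneous P t Q f : homogeneous P (leaves t) ->
  (forall x, 0 <= f x) ->
  0 <= canon_sum P t Q f <= if Q (weight t) then f (weight t) else 0.
Proof.
move=> /orP[fullt|emptyt] f0.
  by rewrite canon_sum_full // lexx andbT; case: ifP.
by rewrite canon_sum_empty // lexx /=; case: ifP.
Qed.

(* At a cut node, only the child [o] that may fail to be homogeneous is worth
   recursing into. *)
Lemma single_cut_ind P (alpha : R) (X : bintree R d A -> Prop) :
  (forall t, homogeneous P (leaves t) -> X t) ->
  (forall t h o, single_cut P t -> bb_tree alpha t ->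
     (forall Q f, canon_sum P t Q f = canon_sum P h Q f + canon_sum P o Q f) ->
     weight t = weight h + weight o ->
     alpha * weight t <= weight h -> alpha * weight t <= weight o ->
     homogeneous P (leaves h) -> X o -> X t) ->
  forall t, single_cut P t -> bb_tree alpha t -> X t.
Proof.
move=> Xhom Xnode; elim=> [p a _ _|a l IHl r IHr].
  by apply: Xhom; rewrite /homogeneous /= orbF andbT orbN.
move=> ct bt; have := ct; have := bt.
move=> /= /and4P[wl wr bl br] /and3P[hom cl cr].
have [fullt|nfull] := boolP (all P (leaves (Node a l r))).
  by apply: Xhom; rewrite /homogeneous fullt.
have wt := weight_node a l r.
case/orP: hom => hom.
  by apply: (Xnode _ l r) (IHr cr br) => // Q f; rewrite canon_sum_node.
apply: (Xnode _ r l) (IHl cl bl) => //; last by rewrite addrC.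
by move=> Q f; rewrite canon_sum_node // addrC.
Qed.

(** Canonical nodes are maximal, hence have disjoint sets of leaves. *)
Lemma canon_sum_le_weight P t Q : canon_sum P t Q id <= weight t.
Proof.
elim: t => [p a|a l IHl r IHr].
  rewrite /canon_sum big_cons big_nil.
  by case: ifP; rewrite ?addr0 // ltW // weight_gt0.
have [fullt|nfull] := boolP (all P (leaves (Node a l r))).
  by rewrite canon_sum_full //; case: ifP; rewrite // ltW // weight_gt0.
by rewrite canon_sum_node // weight_node lerD.
Qed.

(** * Geometric decay of weights in balanced trees *)

Section Balanced.
Variable alpha : R.
Hypotheses (alpha0 : 0 < alpha) (alpha1 : alpha <= 2^-1).
Local Notation q := (1 - alpha).

Let q_gt0 : 0 < q.
Proof. by move: alpha0 alpha1 => ? ?; lra. Qed.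

(** Each step down the cut path meets at most one canonical node, the homogeneous child, and shrinks
    the weight by the factor [q]; after [k] steps everything is lighter than [a]. *)
Lemma canon_count_ge P t Q (a : R) k : single_cut P t -> bb_tree alpha t ->
  weight t * q ^+ k < a ->
  canon_sum P t (fun x => (a <= x) && Q x) (fun=> 1) <= k%:R.
Proof.
move=> ct bt; move: t ct bt k; apply: single_cut_ind => [t hom k wt|].
  have /andP[_ /le_trans->] // :=
    canon_sum_homogeneous (fun x => (a <= x) && Q x) hom (fun=> ler01).
  case: ifP => //; case: k wt => [|k] wt; last by rewrite ler1n.
  by rewrite expr0 mulr1 in wt; rewrite leNgt wt.
move=> t h o _ _ Et wt wh wo hom IH [|k] lta.
  have {}lta : weight t < a by rewrite expr0 mulr1 in lta.
  have w0 := weight_gt0 h.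
  rewrite Et; have := IH 0%N; rewrite expr0 mulr1 => /(_ _).
  have /andP[_] := canon_sum_homogeneous (fun x => (a <= x) && Q x) hom (fun=> ler01).
  have -> : (a <= weight h) = false.
    by apply/negbTE; rewrite -ltNge; have := weight_gt0 o; lra.
  by move=> /= /lerD H /(_ _)/H; rewrite addr0; apply; lra.
rewrite Et -add1n natrD lerD //.
  have /andP[_ /le_trans->] // :=
    canon_sum_homogeneous (fun x => (a <= x) && Q x) hom (fun=> ler01).
  by case: ifP.
apply: IH; apply: le_lt_trans lta; rewrite exprS mulrA.
by rewrite ler_wpM2r ?exprn_ge0 ?(ltW q_gt0) //; lra.
Qed.

(** Along the path, homogeneous children heavier than [b] are not counted. At the first one of
    weight at most [b], balance bounds its parent by [b / alpha], and [canon_count_ge] takes over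
    from there. *)
Lemma canon_count_range P t (a b : R) k : single_cut P t -> bb_tree alpha t ->
  b * q ^+ k < alpha * a ->
  canon_sum P t (fun x => (a <= x) && (x <= b)) (fun=> 1) <= k%:R.
Proof.
move=> ct bt ltab.
have a0 : 0 <= b -> 0 < a.
  move=> b0; rewrite -(pmulr_rgt0 _ alpha0); apply: le_lt_trans ltab.
  by rewrite mulr_ge0 // exprn_ge0 // ltW.
move: t ct bt; apply: single_cut_ind => [t hom|].
  have /andP[_ /le_trans->] // := canon_sum_homogeneous
    (fun x => (a <= x) && (x <= b)) hom (fun=> ler01).
  case: ifP => // /andP[ax xb]; case: k ltab => [|k ltab]; last by rewrite ler1n.
  rewrite expr0 mulr1 => ltab; suff : alpha * a <= 1 * b by rewrite mul1r leNgt ltab.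
  have b0 : 0 <= b by apply: le_trans xb; rewrite ltW // weight_gt0.
  by apply: ler_pM => //; [exact: ltW|exact/ltW/a0|by move: alpha1; lra|exact: le_trans xb].
move=> t h o ct bt Et wt wh wo hom IH.
have [whb|bwh] := leP (weight h) b.
  apply: canon_count_ge => //.
  rewrite -(ltr_pM2l alpha0) mulrA; apply: le_lt_trans ltab.
  by rewrite ler_wpM2r ?exprn_ge0 ?(ltW q_gt0) //; exact: le_trans whb.
rewrite Et -[k%:R]add0r lerD //.
have /andP[_ /le_trans->] // := canon_sum_homogeneous
    (fun x => (a <= x) && (x <= b)) hom (fun=> ler01).
by rewrite [weight h <= b]leNgt bwh andbF.
Qed.

(** The descent stops as in [canon_count_range], at a node of weight at most [b / alpha];
    disjointness of the canonical nodes below it does the rest. *)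
Lemma canon_weight_le P t (b : R) : single_cut P t -> bb_tree alpha t ->
  0 <= b -> alpha * canon_sum P t (fun x => x <= b) id <= b.
Proof.
move=> ct bt b0; move: t ct bt; apply: single_cut_ind => [t hom|].
  case/orP: hom => [fullt|emptyt]; last by rewrite canon_sum_empty // mulr0.
  rewrite canon_sum_full //; case: ifP => [wb|_]; last by rewrite mulr0.
  have w0 := weight_gt0 t; rewrite -[leRHS]mul1r.
  by apply: ler_pM => //; move: alpha0 alpha1; lra.
move=> t h o ct bt Et wt wh wo hom IH.
have [whb|bwh] := leP (weight h) b.
  apply: le_trans whb; apply: le_trans wh.
  by rewrite ler_pM2l // canon_sum_le_weight.
rewrite Et; case/orP: hom => [fullh|emptyh].
  by rewrite canon_sum_full //= [weight h <= b]leNgt bwh add0r.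
by rewrite canon_sum_empty // add0r.
Qed.

(** There are at most [k] levels, since weights are at least 1, and each level has total weight at
    most [weight t]. *)
Lemma sum_node_weight t k : bb_tree alpha t -> weight t * q ^+ k < 1 ->
  \sum_(v <- nodes t) node_weight t v <= k%:R * weight t.
Proof.
elim: t k => [p a|a l IHl r IHr] [|k] bt.
- by rewrite expr0 mulr1 ltNge weight_ge1.
- move=> _; rewrite big_cons big_nil addr0 ler_peMl ?ler1n //.
- by rewrite expr0 mulr1 ltNge weight_ge1.
move=> wk; have := bt => /= /and4P[wl wr bl br].
have w0 := exprn_ge0 k (ltW q_gt0).
have wt := weight_node a l r.
rewrite (big_nodes_node (node_weight _) xpredT a) -natr1 mulrDl mul1r.
rewrite [leRHS]addrC lerD //.
rewrite weight_node mulrDr lerD //.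
  apply: IHl => //; apply: le_lt_trans wk.
  by rewrite exprS mulrA ler_wpM2r //; lra.
apply: IHr => //; apply: le_lt_trans wk.
by rewrite exprS mulrA ler_wpM2r //; lra.
Qed.

(* The potential [K w - h w] with [h] logarithmic absorbs the cost of a node:
   [h] is gained twice at the children and paid once at their parent. *)
Lemma sum_log_node_weight (c c' : R) : 0 <= c -> 0 <= c' ->
  exists2 K : R, 0 <= K & forall t, bb_tree alpha t ->
    \sum_(v <- nodes t) (c * ln (node_weight t v) + c') <= K * weight t.
Proof.
(* [e] pays the constant cost [c'] of a node and, at each of its two children, the possible drop of
   the logarithm by [- ln alpha]. *)
move=> c0 c'0; pose e := c' + 2 * (c * - ln alpha).
have lna : ln alpha <= 0 by apply: ln_le0; move: alpha1; lra.
have e0 : 0 <= e by rewrite /e; have := mulr_ge0 c0 (_ : 0 <= - ln alpha); lra.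
exists (c' + e); first by lra.
move=> t bt; apply: (@le_trans _ _ ((c' + e) * weight t - (c * ln (weight t) + e))).
  elim: t bt => [p a _|a l IHl r IHr].
    rewrite big_cons big_nil addr0 /node_weight /weight /= ln1.
    by lra.
  move=> /= /and4P[wl wr /IHl{}IHl /IHr{}IHr].
  rewrite (big_nodes_node (fun v => c * ln (node_weight _ v) + c') xpredT a) /=.
  rewrite -[node_weight _ [::]]/(weight (Node a l r)).
  have -> : (c' + e) * weight (Node a l r) =
    (c' + e) * weight l + (c' + e) * weight r by rewrite weight_node mulrDr.
  have w0 := weight_gt0 (Node a l r).
  have lnw (s : bintree R d A) : alpha * weight (Node a l r) <= weight s ->
      c * (ln alpha + ln (weight (Node a l r))) <= c * ln (weight s).
    move=> ws; rewrite ler_wpM2l // -lnM ?posrE // ler_ln ?posrE //.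
      by rewrite mulr_gt0.
    exact: weight_gt0.
  have := lnw _ wl; have := lnw _ wr; rewrite !mulrDr.
  move: IHl IHr; rewrite /e.
  lra.
have lnw0 : 0 <= c * ln (weight t) by rewrite mulr_ge0 // ln_ge0 // weight_ge1.
lra.
Qed.

End Balanced.
End Cuts.

(** * Minimal representing sets consist of canonical nodes *)

Section CanonicalSets.
Variables (R : realType) (d : nat) (A : Type).
Local Notation point := 'rV[R]_d.
Implicit Types (t l r : bintree R d A) (u v : address) (c : 'I_d).

(** Keys on the left never exceed keys on the right, so one leaf on the right outside the ray puts
    all leaves on the left outside it. *)
Lemma single_cut_ge c x t : search_tree c t ->
  single_cut (fun p : point => p 0 c \in `[x, +oo[) t.
Proof.
elim: t => //= a l IHl r IHr /and3P[lr /IHl-> /IHr->]; rewrite !andbT.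
have [fullr|] := boolP (all (fun p : point => p 0 c \in `[x, +oo[) (leaves r)).
  by rewrite /homogeneous fullr orbT.
move=> /allPn[p pr]; rewrite in_itv /= andbT -ltNge => px.
apply/orP; left; apply/orP; right; apply/hasPn => p' p'l.
rewrite in_itv /= andbT -ltNge; apply: le_lt_trans px.
exact: (allrelP lr).
Qed.

Lemma single_cut_le c y t : search_tree c t ->
  single_cut (fun p : point => p 0 c \in `]-oo, y]) t.
Proof.
elim: t => //= a l IHl r IHr /and3P[lr /IHl-> /IHr->]; rewrite !andbT.
have [fulll|] := boolP (all (fun p : point => p 0 c \in `]-oo, y]) (leaves l)).
  by rewrite /homogeneous fulll.
move=> /allPn[p pl]; rewrite in_itv /= -ltNge => yp.
apply/orP; right; apply/orP; right; apply/hasPn => p' p'r.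
rewrite in_itv /= -ltNge; apply: lt_le_trans yp _.
exact: (allrelP lr).
Qed.

Lemma mem_nodes_cons a l r b u :
  (b :: u \in nodes (Node a l r)) = (u \in nodes (if b then r else l)).
Proof.
have inj e : injective (cons (e : bool)) by move=> ? ? [].
rewrite /= inE mem_cat /=; case: b.
  rewrite (mem_map (inj true)) [X in X || _]negbTE //.
  by apply/mapP => -[].
rewrite (mem_map (inj false)) orbC [X in X || _]negbTE //.
by apply/mapP => -[].
Qed.

Lemma nodes_root t : [::] \in nodes t.
Proof. by case: t => *; rewrite /= inE. Qed.

Lemma sub_canonical_subset t u : {subset canonical_subset t u <= leaves t}.
Proof.
elim: t u => [p a|a l IHl r IHr] [|b u] // p.
rewrite -[canonical_subset _ _]/(canonical_subset (if b then r else l) u).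
by rewrite /= mem_cat; case: b => [/IHr|/IHl] -> //; rewrite orbT.
Qed.

Lemma mem_canonical_subset_cons a l r b u p :
  p \in canonical_subset (Node a l r) (b :: u) ->
  p \in leaves (if b then r else l).
Proof. by move=> pu; apply: (@sub_canonical_subset (if b then r else l) u). Qed.

Lemma mem_leaves_child a l r b (p : point) :
  p \in leaves (if b then r else l) -> p \in leaves (Node a l r).
Proof. by rewrite /= mem_cat; case: b => ->; rewrite ?orbT. Qed.

Lemma leaves_child_inj a l r b b' (p : point) : uniq (leaves (Node a l r)) ->
  p \in leaves (if b then r else l) -> p \in leaves (if b' then r else l) ->
  b = b'.
Proof.
rewrite /= cat_uniq => /and3P[_ /hasPn disj _].
by case: b; case: b' => // pl pr; have := disj p; rewrite /= ?pl ?pr => /(_ isT).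
Qed.

Lemma canon_child P a l r b u : ~~ all P (leaves (Node a l r)) ->
  canonical_node P (Node a l r) (b :: u) = canonical_node P (if b then r else l) u.
Proof. by move=> /negPf /= ->. Qed.

Lemma canon_full P t u : all P (leaves t) -> canonical_node P t u = (u == [::]).
Proof. by case: t => [p a|a l r] /= ->. Qed.

(** The root is not in [C] and the leaves are distinct, so the part of [C] below a child represents
    that child's share of [I] on its own. *)
Lemma is_canonical_set_child a l r c I b (C : {fset address}) :
  let t := Node a l r in let s := if b then r else l in
  uniq (leaves t) -> ~~ all (fun p : point => p 0 c \in I) (leaves t) ->
  is_canonical_set t c I C ->
  is_canonical_set s c I [fset w in nodes s | b :: w \in C]%fset.
Proof.
move=> t s ut nfull [[Cnodes Crep] Cmin].
have rootC : [::] \notin C.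
  apply: contra nfull => rC; apply/allP => p pt.
  by have /andP[] := (Crep p).1 (ex_intro2 _ _ [::] rC pt).
have memCb w : (w \in [fset w in nodes s | b :: w \in C]%fset) = (b :: w \in C).
  rewrite !inE /= andb_idl // => /Cnodes.
  by rewrite mem_nodes_cons.
split.
  split=> [w|p]; first by rewrite !inE /= => /andP[].
  split=> [[w]|/andP[ps Pp]].
    rewrite memCb => bwC pw; rewrite (sub_canonical_subset pw) /=.
    by have /andP[] := (Crep p).1 (ex_intro2 _ _ (b :: w) bwC pw).
  have [|w wC pw] := (Crep p).2; first by rewrite Pp andbT (mem_leaves_child a ps).
  case: w wC pw => [|b' w] wC pw; first by rewrite wC in rootC.
  have bb' : b = b' by apply: (leaves_child_inj ut ps); exact: mem_canonical_subset_cons pw.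
  by rewrite -bb' in wC pw; exists w; rewrite // memCb.
move=> C' [C'nodes C'rep].
set Cb := [fset w in nodes s | b :: w \in C]%fset in memCb *.
(* Exchange argument: [D] is the part of [C] below the child, and replacing it by a copy of [C']
   yields another representing set [C2] of the whole tree. *)
pose D := [fset b :: w | w in Cb]%fset.
pose C2 := (C `\` D `|` [fset b :: w | w in C'])%fset.
have inj : injective (cons b) by move=> ? ? [].
have DC : (D `<=` C)%fset.
  by apply/fsubsetP => _ /imfsetP[w /= wCb ->]; rewrite -memCb.
have : (#|` C| <= #|` C2|)%N.
  apply: Cmin; split.
    move=> w; rewrite inE => /orP[|/imfsetP[w' w'C' ->]].
      by rewrite inE => /andP[_ /Cnodes].
    by rewrite (mem_nodes_cons a); exact: C'nodes.
  move=> p; split.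
    move=> [w]; rewrite inE => /orP[|/imfsetP[w' /= w'C' ->]].
      by rewrite inE => /andP[_ wC] pw; apply/Crep; exists w.
    move=> pw; have /andP[ps ->] : (p \in leaves s) && (p 0 c \in I).
      by apply/C'rep; exists w'.
    by rewrite andbT (mem_leaves_child a ps).
  move=> /andP[pt Pp]; have [ps|nps] := boolP (p \in leaves s).
    have [|w wC' pw] := (C'rep p).2; first by rewrite ps.
    exists (b :: w); last exact: pw.
    by rewrite inE; apply/orP; right; apply/imfsetP; exists w.
  have [|w wC pw] := (Crep p).2; first by rewrite pt.
  exists w; rewrite // !inE wC andbT; apply/orP; left.
  apply: contra nps => /imfsetP[w' /= _ E]; rewrite E in pw.
  exact: mem_canonical_subset_cons pw.
move=> /leq_trans/(_ (leq_card_fsetU _ _)).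
have cD : #|` D| = #|` Cb| by rewrite card_imfset.
have cC' : #|` [fset b :: w | w in C']%fset| = #|` C'| by rewrite card_imfset.
rewrite cardfsDS // cD cC' -leq_subLR subKn //.
by rewrite -cD fsubset_leq_card.
Qed.

Lemma canonical_node_in_set t c I u : uniq (leaves t) ->
  in_canonical_set t c I u -> canonical_node (fun p : point => p 0 c \in I) t u.
Proof.
move=> ut [C Ccan uC]; elim: t u C ut Ccan uC => [p a|a l IHl r IHr] u C ut.
  move=> [[Cnodes Crep] _] uC; have := Cnodes u uC; rewrite /= inE => /eqP u0.
  have pu : p \in canonical_subset (Leaf p a) u by rewrite u0 inE.
  have /andP[_ Pp] := (Crep p).1 (ex_intro2 _ _ u uC pu).
  by rewrite /= Pp u0.
move=> Ccan uC.
have [fullt|nfull] := boolP (all (fun p : point => p 0 c \in I) (leaves (Node a l r))).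
  rewrite canon_full //.
  have [[Cnodes Crep] Cmin] := Ccan.
  have C1 : (#|` C| <= 1)%N.
    rewrite -(cardfs1 ([::] : address)); apply: Cmin; split.
      by move=> w; rewrite inE => /eqP->; exact: nodes_root.
    move=> p; split=> [[w]|/andP[pt _]].
      rewrite inE => /eqP-> pt; rewrite [_ \in _]pt /=.
      exact: (allP fullt).
    by exists [::]; rewrite ?inE.
  (* The root alone represents [I], so [C] has at most one element. If that element lay below the
     child [b], a leaf of the other child would remain uncovered. *)
  case: u uC => // b u uC.
  have : (0 < size (leaves (if ~~ b then r else l)))%N by exact: size_leaves_gt0.
  case E: (leaves (if ~~ b then r else l)) => [//|p s] _.
  have ps : p \in leaves (if ~~ b then r else l) by rewrite E inE eqxx.
  have pt := mem_leaves_child a ps.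
  have [|w wC pw] := (Crep p).2; first by rewrite pt /=; exact: (allP fullt).
  have wE : w = b :: u.
    apply/eqP; apply: contraTT C1 => wu; rewrite -ltnNge.
    have c2 : #|` [fset w; b :: u]%fset| = 2%N by rewrite cardfs2 wu.
    rewrite -c2; apply: fsubset_leq_card; apply/fsubsetP => v.
    by rewrite !inE => /orP[] /eqP->.
  rewrite wE in pw.
  have := leaves_child_inj ut (mem_canonical_subset_cons pw) ps.
  by case: (b).
case: u uC => [|b u] uC.
  have [[_ Crep] _] := Ccan.
  case/negP: nfull; apply/allP => p pt.
  by have /andP[] := (Crep p).1 (ex_intro2 _ _ [::] uC pt).
have Cb := is_canonical_set_child b ut nfull Ccan.
rewrite canon_child //.
have uCb : u \in [fset w in nodes (if b then r else l) | b :: w \in C]%fset.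
  by rewrite !inE /= uC andbT -(mem_nodes_cons a); case: Ccan => -[+ _] _; apply.
have := ut; rewrite /= cat_uniq => /and3P[ul _ ur].
by case: b uC Cb uCb => _ Cb uCb; [apply: IHr Cb uCb|apply: IHl Cb uCb].
Qed.

End CanonicalSets.

(** Turns geometric decay into a logarithmic number of steps: [k] is one more than the integer part
    of [ln y / - ln q]. *)
Lemma expr_decay (R : realType) (q y : R) : 0 < q -> q < 1 -> 1 <= y ->
  exists2 k : nat, y * q ^+ k < 1 & k%:R <= 1 + (- ln q)^-1 * ln y.
Proof.
move=> q0 q1 y1; have lnq : 0 < - ln q by rewrite oppr_gt0 ln_lt0 // q0.
have y0 : 0 < y by exact: lt_le_trans ltr01 y1.
have z0 : 0 <= (- ln q)^-1 * ln y by rewrite mulr_ge0 ?ln_ge0 // invr_ge0 ltW.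
exists (Num.truncn ((- ln q)^-1 * ln y)).+1; last first.
  by rewrite -add1n natrD lerD2l truncn_le.
set k := (Num.truncn _).+1.
have /andP[_ zk] := truncn_itv z0.
rewrite -(lnK y0) -{1}(lnK q0) -expRM_natl -expRD -[X in _ < X]expR0 ltr_expR.
rewrite -/k in zk *.
have := zk; rewrite mulrC ltr_pdivrMr // => H.
by rewrite mulr_natl in H *; move: H; rewrite -mulr_natl; lra.
Qed.

(** * Sums over linked pairs, seen from one tree *)

Section CutFamily.
Variables (R : realType) (d : nat) (alpha : R).
Hypotheses (alpha0 : 0 < alpha) (alpha1 : alpha <= 2^-1).
Local Notation point := 'rV[R]_d.
Local Notation q := (1 - alpha).

(** [F] stands for the partners of one fixed node of the other tree; this containment is what the
    counting retains of the keys. *)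
Definition cut_family A (s : bintree R d A) (F : pred address) : Prop :=
  exists2 P : pred point, single_cut P s &
    {in nodes s, forall v, F v -> canonical_node P s v}.

Lemma node_weight_le A (t : bintree R d A) u : node_weight t u <= weight t.
Proof.
elim: t u => [p a|a l IHl r IHr] [|b u] //.
rewrite -[node_weight _ _]/(node_weight (if b then r else l) u) weight_node.
have := weight_gt0 l; have := weight_gt0 r.
by case: b; [have := IHr u|have := IHl u]; lra.
Qed.

Lemma node_weight_gt0 A (t : bintree R d A) u : 0 < node_weight t u.
Proof. exact: weight_gt0. Qed.

Lemma node_weight_ge1 A (t : bintree R d A) u : 1 <= node_weight t u.
Proof. exact: weight_ge1. Qed.

Lemma cut_family_sum A (s : bintree R d A) (F : pred address) P (Q : pred R)
    (f : R -> R) :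
  {in nodes s, forall v, F v -> canonical_node P s v} ->
  (forall x, 0 <= x -> 0 <= f x) ->
  \sum_(v <- nodes s | F v && Q (node_weight s v)) f (node_weight s v) <=
  canon_sum P s Q f.
Proof.
move=> FP f0; rewrite /canon_sum big_seq_cond [leRHS]big_seq_cond.
rewrite big_mkcond [leRHS]big_mkcond; apply: ler_sum => v _.
have [vs|] //= := boolP (v \in nodes s).
have [Fv|_] := boolP (F v); first by rewrite FP.
by rewrite /=; case: ifP => // _; apply: f0; exact/ltW/node_weight_gt0.
Qed.

Lemma cut_family_count_range A (s : bintree R d A) (F : pred address) (a b : R) k :
  bb_tree alpha s -> cut_family s F -> b * q ^+ k < alpha * a ->
  \sum_(v <- nodes s | F v && ((a <= node_weight s v) && (node_weight s v <= b))) 1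
    <= k%:R :> R.
Proof.
move=> bs [P cP FP] ab.
apply: le_trans (canon_count_range alpha0 alpha1 cP bs ab).
exact: (cut_family_sum (fun x => (a <= x) && (x <= b)) FP (fun _ _ => ler01)).
Qed.

Lemma cut_family_count A (s : bintree R d A) (F : pred address) k :
  bb_tree alpha s -> cut_family s F -> weight s * q ^+ k < 1 ->
  \sum_(v <- nodes s | F v) 1 <= k%:R :> R.
Proof.
move=> bs [P cP FP] ab.
apply: le_trans (canon_count_ge alpha0 alpha1 xpredT cP bs ab).
apply: le_trans (cut_family_sum _ FP (fun _ _ => ler01)).
by rewrite [leRHS](eq_bigl F) // => v; rewrite node_weight_ge1 !andbT.
Qed.

Lemma cut_family_weight_le A (s : bintree R d A) (F : pred address) (b : R) :
  bb_tree alpha s -> cut_family s F -> 0 <= b ->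
  \sum_(v <- nodes s | F v && (node_weight s v <= b)) node_weight s v <=
  alpha^-1 * b.
Proof.
move=> bs [P cP FP] b0.
rewrite ler_pdivlMl //.
have := canon_weight_le alpha0 alpha1 cP bs b0; apply: le_trans.
rewrite ler_pM2l //.
exact: (cut_family_sum (fun x => x <= b) FP (f := id)).
Qed.

Section OneSided.
Variables (A B : Type) (t : bintree R d A) (s : bintree R d B).
Variable E : address -> address -> bool.
Hypotheses (bt : bb_tree alpha t) (bs : bb_tree alpha s).
Hypothesis Es : {in nodes t, forall u, cut_family s (E u)}.
Local Notation wt := (node_weight t).
Local Notation ws := (node_weight s).

(** One factor [lambda] bounds the number of partners of a node, the other the number of levels of
    [t]. *)
Lemma linked_sum_weight lambda :
  weight t * q ^+ lambda < 1 -> weight s * q ^+ lambda < 1 ->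
  \sum_(u <- nodes t) \sum_(v <- nodes s | E u v) wt u <=
  lambda%:R ^+ 2 * weight t.
Proof.
move=> tl sl; apply: (@le_trans _ _ (\sum_(u <- nodes t) lambda%:R * wt u)).
  rewrite big_seq [leRHS]big_seq; apply: ler_sum => u ut.
  rewrite (eq_bigr (fun=> 1 * wt u)) => [|v _]; last by rewrite mul1r.
  have w0 := ltW (node_weight_gt0 t u); rewrite -mulr_suml ler_wpM2r //.
  by apply: cut_family_count => //; exact: Es.
by rewrite -mulr_sumr expr2 -mulrA ler_wpM2l // (sum_node_weight alpha0 alpha1).
Qed.

(** Near partners of [u] have weights between [wt u / D] and [D * wt u], a range of ratio [D ^+ 2],
    so there are at most [k] of them. *)
Lemma linked_sum_near lambda k (D : R) : 0 < D -> D ^+ 2 * q ^+ k < alpha ->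
  weight t * q ^+ lambda < 1 ->
  \sum_(u <- nodes t) \sum_(v <- nodes s |
      E u v && ((wt u <= D * ws v) && (ws v <= D * wt u))) wt u <=
  (lambda * k)%:R * weight t.
Proof.
move=> D0 Dk tl; apply: (@le_trans _ _ (\sum_(u <- nodes t) k%:R * wt u)).
  rewrite big_seq [leRHS]big_seq; apply: ler_sum => u ut.
  rewrite (eq_bigr (fun=> 1 * wt u)) => [|v _]; last by rewrite mul1r.
  have w0 := node_weight_gt0 t u.
  have w1 := ltW w0; rewrite -mulr_suml ler_wpM2r //.
  under eq_bigl => v do rewrite -ler_pdivrMl //.
  apply: cut_family_count_range => //; first exact: Es.
  rewrite [alpha * _]mulrCA ltr_pdivlMl //.
  have -> : D * (D * wt u * q ^+ k) = D ^+ 2 * q ^+ k * wt u by ring.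
  by rewrite ltr_pM2r.
have -> : (lambda * k)%:R * weight t = k%:R * (lambda%:R * weight t).
  by rewrite natrM; ring.
by rewrite -mulr_sumr ler_wpM2l // (sum_node_weight alpha0 alpha1).
Qed.

Lemma linked_sum_far lambda (D : R) : 0 < D -> weight t * q ^+ lambda < 1 ->
  \sum_(u <- nodes t) \sum_(v <- nodes s | E u v && (D * ws v < wt u)) ws v <=
  lambda%:R * alpha^-1 * D^-1 * weight t.
Proof.
move=> D0 tl.
apply: (@le_trans _ _ (\sum_(u <- nodes t) (alpha^-1 * D^-1) * wt u)).
  rewrite big_seq [leRHS]big_seq; apply: ler_sum => u ut.
  have b0 : 0 <= D^-1 * wt u.
    by rewrite mulr_ge0 ?invr_ge0 // ltW // node_weight_gt0.
  rewrite -mulrA; apply: le_trans (cut_family_weight_le bs (Es ut) b0).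
  rewrite big_mkcond [leRHS]big_mkcond; apply: ler_sum => v _.
  have := node_weight_gt0 s v.
  case: (E u v) => //=; rewrite ler_pdivlMl // => w0.
  by case: ltP => [/ltW->//|_]; case: ifP => // _; exact: ltW.
have -> : lambda%:R / alpha / D * weight t =
    alpha^-1 * D^-1 * (lambda%:R * weight t) by ring.
rewrite -mulr_sumr ler_wpM2l ?(sum_node_weight alpha0 alpha1) //.
by rewrite mulr_ge0 // invr_ge0 ltW.
Qed.

End OneSided.
End CutFamily.

(** * Sums over linked pairs, combined from both trees *)

Section LinkedPairs.
Variables (R : realType) (d : nat) (alpha : R).
Hypotheses (alpha0 : 0 < alpha) (alpha1 : alpha <= 2^-1).
Local Notation point := 'rV[R]_d.
Local Notation q := (1 - alpha).

Lemma linked_count_lighter (A : Type) : exists2 K : R, 0 <= K &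
  forall (B : Type) (t : bintree R d A) (s : bintree R d B)
         (E : address -> address -> bool),
    bb_tree alpha t -> bb_tree alpha s ->
    {in nodes t, forall u, cut_family s (E u)} ->
    \sum_(u <- nodes t) \sum_(v <- nodes s |
        E u v && (node_weight s v <= node_weight t u)) 1 <= K * weight t.
Proof.
have q0 : 0 < q by move: alpha1; lra.
have q1 : q < 1 by move: alpha0; lra.
have lnq : 0 < - ln q by rewrite oppr_gt0 ln_lt0 // q0.
have lna : ln alpha <= 0 by apply: ln_le0; move: alpha1; lra.
have c0 : 0 <= (- ln q)^-1 by rewrite invr_ge0 ltW.
have c'0 : 0 <= 1 - (- ln q)^-1 * ln alpha.
  by have := mulr_ge0 c0 (_ : 0 <= - ln alpha); lra.
have [K K0 HK] := sum_log_node_weight d A alpha0 alpha1 c0 c'0.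
exists K => // B t s E bt bs Es; apply: le_trans (HK _ bt).
rewrite big_seq [leRHS]big_seq; apply: ler_sum => u ut.
have w1 := node_weight_ge1 t u; have w0 := node_weight_gt0 t u.
(* The lighter partners have weights between 1 and that of [u]; counting this range requires
   [node_weight t u * q ^+ k < alpha], whence the quotient by [alpha]. *)
have y1 : 1 <= node_weight t u / alpha.
  by rewrite ler_pdivlMr // mul1r; move: alpha1; lra.
have [k yk kle] := expr_decay q0 q1 y1.
have Eu : cut_family s (E u) by exact: Es.
have wk : node_weight t u * q ^+ k < alpha * 1.
  by move: yk; rewrite mulrAC ltr_pdivrMr // mul1r mulr1.
have := cut_family_count_range alpha0 alpha1 bs Eu wk.
under eq_bigl => v do rewrite node_weight_ge1 /=.
move=> /le_trans; apply; apply: le_trans kle _.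
by rewrite lnM ?posrE ?invr_gt0 // lnV ?posrE //; lra.
Qed.

Section TwoSided.
Variables (A B : Type) (t : bintree R d A) (s : bintree R d B).
Variable E : address -> address -> bool.
Hypotheses (bt : bb_tree alpha t) (bs : bb_tree alpha s).
Hypothesis Es : {in nodes t, forall u, cut_family s (E u)}.
Hypothesis Et : {in nodes s, forall v, cut_family t (E^~ v)}.
Local Notation wt := (node_weight t).
Local Notation ws := (node_weight s).

Lemma exchange_linked_sum (Q : address -> address -> bool)
    (G : address -> address -> R) :
  \sum_(u <- nodes t) \sum_(v <- nodes s | E u v && Q u v) G u v =
  \sum_(v <- nodes s) \sum_(u <- nodes t | E u v && Q u v) G u v.
Proof. by rewrite (exchange_big_dep xpredT). Qed.

(** Here [H] is the sharp bound per unit of weight, spent on near pairs, and [M] the crude one,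
    spent on the lighter node of a far pair, where [M <= D] cancels the gain [D^-1]. *)
Lemma linked_sum_le lambda k (D H M : R) (G : address -> address -> R) :
  0 < D -> 0 <= H -> 0 <= M <= D -> D ^+ 2 * q ^+ k < alpha ->
  weight t * q ^+ lambda < 1 -> weight s * q ^+ lambda < 1 ->
  {in nodes t & nodes s, forall u v, E u v ->
    [/\ G u v <= H * (wt u + ws v), G u v <= M * wt u & G u v <= M * ws v]} ->
  \sum_(u <- nodes t) \sum_(v <- nodes s | E u v) G u v <=
  (H * (lambda * k)%:R + lambda%:R * alpha^-1) * (weight t + weight s).
Proof.
move=> D0 H0 /andP[M0 MD] Dk tl sl HG.
pose near u v := (wt u <= D * ws v) && (ws v <= D * wt u).
have near1 : \sum_(u <- nodes t) \sum_(v <- nodes s | E u v && near u v) H * wt u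
    <= H * ((lambda * k)%:R * weight t).
  under eq_bigr do rewrite -mulr_sumr.
  by rewrite -mulr_sumr ler_wpM2l // (linked_sum_near alpha0 alpha1 bt bs Es D0 Dk).
have near2 : \sum_(u <- nodes t) \sum_(v <- nodes s | E u v && near u v) H * ws v
    <= H * ((lambda * k)%:R * weight s).
  rewrite exchange_linked_sum; under eq_bigr do rewrite -mulr_sumr.
  rewrite -mulr_sumr ler_wpM2l //.
  apply: le_trans (linked_sum_near alpha0 alpha1 bs bt Et D0 Dk sl).
  rewrite le_eqVlt; apply/orP; left; apply/eqP.
  by apply: eq_bigr => v _; apply: eq_bigl => u; rewrite /near [X in _ && X]andbC.
have farM w : 0 <= w ->
    M * (lambda%:R * alpha^-1 * D^-1 * w) <= lambda%:R * alpha^-1 * w.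
  move=> w0; have -> : M * (lambda%:R * alpha^-1 * D^-1 * w) =
    M / D * (lambda%:R * alpha^-1 * w) by ring.
  rewrite ler_piMl //; first by rewrite !mulr_ge0 // invr_ge0 ltW.
  by rewrite ler_pdivrMr // mul1r.
have far1 : \sum_(u <- nodes t) \sum_(v <- nodes s | E u v && (D * ws v < wt u))
    M * ws v <= lambda%:R * alpha^-1 * weight t.
  under eq_bigr do rewrite -mulr_sumr.
  apply: le_trans (farM _ (ltW (weight_gt0 t))).
  by rewrite -mulr_sumr ler_wpM2l // (linked_sum_far alpha0 alpha1 bt bs Es D0).
have far2 : \sum_(u <- nodes t) \sum_(v <- nodes s | E u v && (D * wt u < ws v))
    M * wt u <= lambda%:R * alpha^-1 * weight s.
  rewrite exchange_linked_sum; under eq_bigr do rewrite -mulr_sumr.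
  apply: le_trans (farM _ (ltW (weight_gt0 s))).
  by rewrite -mulr_sumr ler_wpM2l // (linked_sum_far alpha0 alpha1 bs bt Et D0).
have -> : (H * (lambda * k)%:R + lambda%:R / alpha) * (weight t + weight s) =
    H * ((lambda * k)%:R * weight t) + H * ((lambda * k)%:R * weight s) +
    lambda%:R * alpha^-1 * weight t + lambda%:R * alpha^-1 * weight s by ring.
apply: le_trans (lerD (lerD (lerD near1 near2) far1) far2).
rewrite -!big_split /= big_seq [leRHS]big_seq; apply: ler_sum => u ut.
rewrite [leLHS]big_mkcond [X in _ <= X + _ + _ + _]big_mkcond.
rewrite [X in _ <= _ + X + _ + _]big_mkcond [X in _ <= _ + _ + X + _]big_mkcond.
rewrite [X in _ <= _ + _ + _ + X]big_mkcond -!big_split /=.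
rewrite big_seq [leRHS]big_seq; apply: ler_sum => v vs; have := HG u v ut vs.
case: (E u v) => /=; last by rewrite !addr0.
move=> /(_ isT) [G1 G2 G3]; rewrite /near.
have pos1 := mulr_ge0 M0 (ltW (node_weight_gt0 t u)).
have pos2 := mulr_ge0 M0 (ltW (node_weight_gt0 s v)).
(* After padding with zeros the four sums are compared term by term. A pair is far in both
   directions only if [D < 1], and then the bound by [M * ws v] suffices. *)
have [h1|h1] := leP (wt u) (D * ws v); have [h2|h2] := leP (ws v) (D * wt u);
  rewrite /= ?add0r ?addr0 //; first by rewrite -mulrDr.
by rewrite (le_trans G3) // lerDl.
Qed.

(** A layer costs a factor [lambda ^+ 2]. Both bounds are carried along because the lighter node of
    a far pair may lie in either tree. *)
Lemma linked_sum_polylog lambda (M : R) (G : address -> address -> R) :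
  0 <= M -> weight t * q ^+ lambda < 1 -> weight s * q ^+ lambda < 1 ->
  {in nodes t & nodes s, forall u v, E u v ->
     G u v <= M * wt u /\ G u v <= M * ws v} ->
  \sum_(u <- nodes t) \sum_(v <- nodes s | E u v) G u v <=
    lambda%:R ^+ 2 * M * weight t /\
  \sum_(u <- nodes t) \sum_(v <- nodes s | E u v) G u v <=
    lambda%:R ^+ 2 * M * weight s.
Proof.
move=> M0 tl sl HG; split; rewrite [_ * M]mulrC -mulrA.
  apply: le_trans (ler_wpM2l M0 (linked_sum_weight alpha0 alpha1 bt bs Es tl sl)).
  rewrite mulr_sumr big_seq [leRHS]big_seq; apply: ler_sum => u ut.
  rewrite mulr_sumr big_seq_cond [leRHS]big_seq_cond.
  by apply: ler_sum => v /andP[vs Euv]; have [] := HG u v ut vs Euv.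
apply: le_trans (ler_wpM2l M0 (linked_sum_weight alpha0 alpha1 bs bt Et sl tl)).
rewrite (exchange_big_dep xpredT) //=.
rewrite mulr_sumr big_seq [leRHS]big_seq; apply: ler_sum => v vs.
rewrite mulr_sumr big_seq_cond [leRHS]big_seq_cond.
by apply: ler_sum => u /andP[ut Euv]; have [] := HG u v ut vs Euv.
Qed.

End TwoSided.

(** Every linked pair is counted from its heavier node. *)
Lemma linked_count_linear (A : Type) : exists2 K : R, 0 <= K &
  forall (t s : bintree R d A) (E : address -> address -> bool),
    bb_tree alpha t -> bb_tree alpha s ->
    {in nodes t, forall u, cut_family s (E u)} ->
    {in nodes s, forall v, cut_family t (E^~ v)} ->
    \sum_(u <- nodes t) \sum_(v <- nodes s | E u v) 1 <=
    K * (weight t + weight s).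
Proof.
have [K K0 HK] := linked_count_lighter A; exists K => // t s E bt bs Es Et.
rewrite mulrDr.
apply: le_trans (lerD (HK _ _ _ _ bt bs Es) (HK _ _ _ _ bs bt Et)).
rewrite -(exchange_linked_sum t s E (fun u v => node_weight t u <= node_weight s v)
  (fun _ _ => 1)).
rewrite -big_split /=; apply: ler_sum => u _.
rewrite [leLHS]big_mkcond [X in _ <= X + _]big_mkcond.
rewrite [X in _ <= _ + X]big_mkcond -big_split /=; apply: ler_sum => v _.
case: (E u v); rewrite /= ?addr0 //.
case/orP: (le_total (node_weight t u) (node_weight s v)) => ->.
  by rewrite lerDr; case: ifP.
by rewrite lerDl; case: ifP.
Qed.

End LinkedPairs.

(** * Recursion over the layers of range trees *)

Section Layers.
Variables (R : realType) (d : nat) (alpha : R).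
Local Notation point := 'rV[R]_d.
Local Notation q := (1 - alpha).
Implicit Types (c : 'I_d) (cs : seq 'I_d).

Definition link_count cs (tR tB : layers R cs) : R :=
  \sum_(u <- lowest_nodes tR) \sum_(v <- lowest_nodes tB)
    (`[< linked tR tB u v >])%:R.

Lemma eq_in_canonical_nodes (I J : 'I_d -> interval R) cs (t : layers R cs) w :
  {in cs, I =1 J} -> in_canonical_nodes I t w -> in_canonical_nodes J t w.
Proof.
elim: cs t w => // c cs IH t [|u w] //= IJ [uC wC]; split.
  by rewrite -IJ ?inE ?eqxx.
by apply: IH wC => c' c'cs; apply: IJ; rewrite inE c'cs orbT.
Qed.

Section FirstLayer.
Variables (c : 'I_d) (cs : seq 'I_d).
Hypothesis c_cs : c \notin cs.
Implicit Types tR tB : bintree R d (layers R cs).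

Definition first_linked tR tB u v : bool :=
  `[< in_canonical_set tB c
        `[max_seq [seq p 0 c | p : point <- canonical_subset tR u], +oo[ v >] &&
  `[< in_canonical_set tR c
        `]-oo, min_seq [seq p 0 c | p : point <- canonical_subset tB v]] u >].

(** As [c] does not recur in [cs], the corners agree on [cs] with those of the shorter chains in the
    associated trees, so a link splits layer by layer. *)
Lemma linked_cons tR tB u v w z :
  @linked R d (c :: cs) tR tB (u :: w) (v :: z) ->
  first_linked tR tB u v /\
  linked (label (subtree tR u)) (label (subtree tB v)) w z.
Proof.
have c_neq c' : c' \in cs -> (c' == c) = false.
  by move=> c'cs; apply: contraNF c_cs => /eqP<-.
move=> [[vC zC] [uC wC]]; split.
  by apply/andP; split; apply/asboolP; move: vC uC; rewrite !mxE /= eqxx.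
split.
  by apply: eq_in_canonical_nodes zC => c' c'cs; rewrite /= !mxE /= c_neq.
by apply: eq_in_canonical_nodes wC => c' c'cs; rewrite /= !mxE /= c_neq.
Qed.

Lemma link_count_cons tR tB :
  @link_count (c :: cs) tR tB <=
  \sum_(u <- nodes tR) \sum_(v <- nodes tB | first_linked tR tB u v)
     link_count (label (subtree tR u)) (label (subtree tB v)).
Proof.
rewrite /link_count /= big_allpairs_dep; apply: ler_sum => u _.
under eq_bigr do rewrite big_allpairs_dep.
rewrite exchange_big /= [leRHS]big_mkcond; apply: ler_sum => v _.
case: ifP => [_|nE].
  apply: ler_sum => w _; apply: ler_sum => z _.
  rewrite ler_nat; have [/asboolP/linked_cons[_ /asboolP->]|] // := boolP `[< _ >].
rewrite big1 // => w _; rewrite big1 // => z _.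
by have [/asboolP/linked_cons[]|//] := boolP `[< _ >]; rewrite nE.
Qed.

Lemma first_linked_cut_right tR tB : uniq (leaves tB) -> search_tree c tB ->
  forall u, cut_family tB (first_linked tR tB u).
Proof.
move=> uB sB u; exists (fun p : point => p 0 c \in
    `[max_seq [seq p 0 c | p : point <- canonical_subset tR u], +oo[).
  exact: single_cut_ge.
by move=> v _ /andP[/asboolP/canonical_node_in_set-> //].
Qed.

Lemma first_linked_cut_left tR tB : uniq (leaves tR) -> search_tree c tR ->
  forall v, cut_family tR (first_linked tR tB ^~ v).
Proof.
move=> uR sR v; exists (fun p : point => p 0 c \in
    `]-oo, min_seq [seq p 0 c | p : point <- canonical_subset tB v]]).
  exact: single_cut_le.
by move=> u _ /andP[_ /asboolP/canonical_node_in_set-> //].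
Qed.

End FirstLayer.

Lemma uniq_canonical_subset A (t : bintree R d A) u :
  uniq (leaves t) -> uniq (canonical_subset t u).
Proof.
elim: t u => [p a|a l IHl r IHr] [|b u] //.
rewrite /= cat_uniq => /and3P[ul _ ur].
by case: b; [apply: IHr|apply: IHl].
Qed.

Hypotheses (alpha0 : 0 < alpha) (alpha1 : alpha <= 2^-1).

Lemma link_count_nil (tR tB : layers R [::]) : link_count tR tB <= 1.
Proof.
rewrite /link_count /= !big_cons !big_nil !addr0.
by case: `[< _ >]; rewrite ?ler01.
Qed.

Definition layered cs (S : seq point) (t : layers R cs) (lambda : nat) :=
  [/\ uniq S, (0 < size S)%N, (size S)%:R * q ^+ lambda < 1 &
      is_layers alpha S t].

Lemma layered_cons c cs S (t : layers R (c :: cs)) lambda :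
  layered S t lambda ->
  [/\ uniq (leaves t), search_tree c t, bb_tree alpha t,
      weight t = (size S)%:R & weight t * q ^+ lambda < 1] /\
  {in nodes t, forall u, layered (canonical_subset t u) (label (subtree t u)) lambda}.
Proof.
move=> [uS S0 Sl /= [St ct bt lt]].
have ut : uniq (leaves t) by rewrite (perm_uniq St).
have wt : weight t = (size S)%:R by rewrite /weight (perm_size St).
split; first by rewrite wt.
move=> u un; split; last exact: lt.
- exact: uniq_canonical_subset.
- exact: size_leaves_gt0.
apply: le_lt_trans Sl; rewrite -wt ler_wpM2r ?node_weight_le //.
by rewrite exprn_ge0 //; move: alpha1; lra.
Qed.

Lemma link_count_polylog cs SR SB (tR tB : layers R cs) lambda : uniq cs ->
  layered SR tR lambda -> layered SB tB lambda ->
  link_count tR tB <= (lambda%:R ^+ 2) ^+ size cs * (size SR)%:R /\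
  link_count tR tB <= (lambda%:R ^+ 2) ^+ size cs * (size SB)%:R.
Proof.
elim: cs SR SB tR tB => [|c cs IH] SR SB tR tB.
  move=> _ [_ SR0 _ _] [_ SB0 _ _]; rewrite expr0 !mul1r.
  by split; apply: le_trans (link_count_nil _ _) _; rewrite ler1n.
move=> /= /andP[ccs ucs] /layered_cons[[uR sR bR <- lR] LR].
move=> /layered_cons[[uB sB bB <- lB] LB].
have := linked_sum_polylog alpha0 alpha1 bR bB
  (fun u _ => first_linked_cut_right tR uB sB u)
  (fun v _ => first_linked_cut_left tB uR sR v) (M := (lambda%:R ^+ 2) ^+ size cs)
  (G := fun u v => link_count (label (subtree tR u)) (label (subtree tB v))) _ lR lB.
have M0 : 0 <= (lambda%:R ^+ 2) ^+ size cs :> R by rewrite !exprn_ge0.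
rewrite [_ ^+ (size cs).+1]exprS => -[//||H1 H2].
  by move=> u v uR' vB' _; apply: IH => //; [exact: LR|exact: LB].
by split; apply: le_trans (link_count_cons ccs tR tB) _.
Qed.

Lemma link_count_near_linear : exists2 K : R, 0 <= K &
  forall cs SR SB (tR tB : layers R cs) lambda k (D : R), uniq cs ->
    (0 < size cs)%N -> (0 < lambda)%N -> (0 < k)%N ->
    0 < D -> (lambda%:R ^+ 2) ^+ size cs <= D -> D ^+ 2 * q ^+ k < alpha ->
    layered SR tR lambda -> layered SB tB lambda ->
    link_count tR tB <= (K + (size cs)%:R * alpha^-1) *
       (lambda * k)%:R ^+ (size cs - 1) * ((size SR)%:R + (size SB)%:R).
Proof.
(* [layers R [::]] is [unit], so this is the bound for lowest-layer trees, the base case. *)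
have [K K0 HK] := linked_count_linear d alpha0 alpha1 unit.
exists K => // cs SR SB tR tB lambda k D ucs cs0 lambda0 k0 D0 csD Dk.
have ia0 : 0 <= alpha^-1 by rewrite invr_ge0 ltW.
elim: cs SR SB tR tB ucs cs0 csD => // c [|c2 cs] IH SR SB tR tB.
  move=> _ _ _ /layered_cons[[uR sR bR <- lR] LR].
  move=> /layered_cons[[uB sB bB <- lB] LB].
  rewrite subnn expr0 mulr1.
  apply: le_trans (link_count_cons (isT : c \notin [::]) tR tB) _.
  have {}HK := HK tR tB (@first_linked c [::] tR tB) bR bB
    (fun u _ => @first_linked_cut_right c [::] tR tB uB sB u)
    (fun v _ => @first_linked_cut_left c [::] tR tB uR sR v).
  apply: le_trans (le_trans HK _).
    by apply: ler_sum => u _; apply: ler_sum => v _; exact: link_count_nil.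
  have w0 : 0 <= weight tR + weight tB by rewrite addr_ge0 ?(ltW (weight_gt0 _)).
  by rewrite ler_wpM2r //= mul1r lerDl.
move=> /andP[ccs ucs] _ csD /layered_cons[[uR sR bR <- lR] LR].
move=> /layered_cons[[uB sB bB <- lB] LB].
set e := size cs.
have lam1 : 1 <= lambda%:R ^+ 2 :> R by rewrite exprn_ege1 // ler1n.
have csD' : (lambda%:R ^+ 2) ^+ size (c2 :: cs) <= D.
  by apply: le_trans csD; rewrite [leRHS]exprS ler_peMl // exprn_ge0 // exprn_ge0.
(* [H] is the inductive bound for the remaining layers; the crude factor is their power of
   [lambda ^+ 2], still at most the fixed [D]. *)
pose H : R := (K + (size (c2 :: cs))%:R * alpha^-1) * (lambda * k)%:R ^+ e.
have H0 : 0 <= H by rewrite mulr_ge0 ?exprn_ge0 // addr_ge0 // mulr_ge0.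
have M0 : 0 <= ((lambda%:R ^+ 2) ^+ size (c2 :: cs) : R) <= D.
  by apply/andP; split; rewrite // exprn_ge0 ?exprn_ge0.
have := linked_sum_le alpha0 alpha1 bR bB
  (fun u _ => @first_linked_cut_right c (c2 :: cs) tR tB uB sB u)
  (fun v _ => @first_linked_cut_left c (c2 :: cs) tR tB uR sR v) D0 H0 M0 Dk lR lB
  (G := fun u v => @link_count (c2 :: cs) (label (subtree tR u))
                                         (label (subtree tB v))).
move=> /(_ _) HS.
apply: le_trans (@link_count_cons c (c2 :: cs) ccs tR tB) (le_trans (HS _) _).
  move=> u v uR' vB' _; have LRu := LR u uR'; have LBv := LB v vB'.
  have [P1 P2] := @link_count_polylog (c2 :: cs) _ _ _ _ _ ucs LRu LBv; split=> //.
  by have := IH _ _ _ _ ucs isT csD' LRu LBv; rewrite /= subn1.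
rewrite ler_wpM2r ?addr_ge0 ?(ltW (weight_gt0 _)) //.
have -> : (size (c :: c2 :: cs) - 1 = e.+1)%N by rewrite /= subn1.
have lk1 : 1 <= (lambda * k)%:R :> R by rewrite ler1n muln_gt0 lambda0.
(* The contribution of far pairs is absorbed by raising the constant by [alpha^-1] in each layer. *)
have step : lambda%:R * alpha^-1 <= alpha^-1 * (lambda * k)%:R ^+ e.+1.
  rewrite mulrC ler_wpM2l // exprSr; apply: le_trans (_ : (lambda * k)%:R <= _).
    by rewrite ler_nat leq_pmulr.
  by rewrite ler_peMl ?exprn_ege1.
apply: le_trans (lerD (lexx _) step) _.
have -> : (size [:: c, c2 & cs])%:R = (size (c2 :: cs))%:R + 1 :> R by rewrite natr1.
by rewrite /H exprSr le_eqVlt; apply/orP; left; apply/eqP; ring.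
Qed.

End Layers.

(** * Choice of the parameters and the final bound *)

Lemma card_links_le (R : realType) (d : nat) (tR tB : layers R (enum 'I_d)) :
  (#|` links (Some tR) (Some tB)|)%:R <= link_count tR tB.
Proof.
set s := [seq (u, v) | u <- lowest_nodes tR, v <- lowest_nodes tB].
apply: (@le_trans _ _ (count (fun uv => `[< linked tR tB uv.1 uv.2 >]) s)%:R).
  rewrite ler_nat -size_filter; apply: uniq_leq_size; first exact: fset_uniq.
  by move=> uv; rewrite mem_filter !inE andbC.
rewrite -sum1_count big_mkcond natr_sum big_allpairs /link_count.
by apply: ler_sum => u _; apply: ler_sum => v _; case: `[< _ >].
Qed.

Lemma is_layers_size_gt0 (R : realType) (d : nat) (alpha : R) (cs : seq 'I_d)
    (S : seq 'rV[R]_d) (t : layers R cs) :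
  (0 < size cs)%N -> is_layers alpha S t -> (0 < size S)%N.
Proof.
by case: cs t => // c cs t _ /= [/perm_size <- _ _ _]; exact: size_leaves_gt0.
Qed.

Theorem theorem17 (R : realType) (d : nat) (alpha : R) :
  (1 <= d)%N -> 0 < alpha -> alpha <= 2^-1 ->
  exists (K : R) (N : nat),
    forall (n m : nat) (RR BB : {fset 'rV[R]_d}) (TR TB : range_tree R d),
      (N <= n)%N -> (m <= n)%N ->
      #|` RR| = n -> #|` BB| = m ->
      is_range_tree alpha RR TR -> is_range_tree alpha BB TB ->
      (#|` links TR TB|)%:R <=
        K * (n%:R * (ln n%:R * ln (ln n%:R)) ^+ (d - 1)).
Proof.
move=> d1 alpha0 alpha1.
have [K1 K10 HK1] := link_count_near_linear d alpha0 alpha1.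
have q0 : 0 < 1 - alpha by lra.
have q1 : 1 - alpha < 1 by lra.
have c0 : 0 <= (- ln (1 - alpha))^-1.
  by rewrite invr_ge0 oppr_ge0 ln_le0 // ltW.
set c := (- ln (1 - alpha))^-1 in c0.
have lna : ln alpha <= 0 by apply: ln_le0; lra.
have ln1c : 0 <= ln (1 + c) by rewrite ln_ge0 // lerDl.
(* [C2] is chosen to give [k <= C2 * ln (ln n)], from [k <= 1 + c * ln (D ^+ 2 / alpha)] with [D]
   the power [2 * d] of [lambda <= (1 + c) * ln n]. *)
pose C2 : R := 1 + c * ((4 * d)%:R * (ln (1 + c) + 1) - ln alpha).
have d40 : 0 <= (4 * d)%:R * (ln (1 + c) + 1) - ln alpha.
  by rewrite addr_ge0 ?oppr_ge0 // mulr_ge0 // addr_ge0.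
have C20 : 0 <= C2 by rewrite addr_ge0 // mulr_ge0.
have K0 : 0 <= 2 * (K1 + d%:R * alpha^-1) * ((1 + c) * C2) ^+ (d - 1).
  rewrite mulr_ge0 ?exprn_ge0 ?mulr_ge0 ?addr_ge0 ?mulr_ge0 //.
  by rewrite invr_ge0 ltW.
exists (2 * (K1 + d%:R * alpha^-1) * ((1 + c) * C2) ^+ (d - 1)).
(* From this threshold on [ln (ln n)] is at least 1, so additive constants can be absorbed into
   it. *)
exists (Num.truncn (expR (expR 1) : R)).+1 => n m RR BB TR TB Nn mn cR cB hR hB.
have nE : expR (expR 1) <= n%:R :> R.
  by apply: le_trans (ltW (truncnS_gt _)) _; rewrite ler_nat.
have n0 : 0 < n%:R :> R by apply: lt_le_trans nE; exact: expR_gt0.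
have LE : expR 1 <= ln n%:R :> R.
  by rewrite -[leLHS]expRK ler_ln ?posrE ?expR_gt0.
have L0 : 0 < ln n%:R :> R by apply: lt_le_trans LE; exact: expR_gt0.
have LL1 : 1 <= ln (ln n%:R) :> R.
  by rewrite -[leLHS]expRK ler_ln ?posrE ?expR_gt0.
have L1 : 1 <= ln n%:R :> R.
  by apply: le_trans LE; have := expR_ge1Dx (1 : R); lra.
set L := ln n%:R in LE L0 LL1 L1 *; set LL := ln L in LL1 *.
have n1 : 1 <= n%:R :> R by rewrite ler1n -(ltr_nat R).
have rhs0 : 0 <= 2 * (K1 + d%:R / alpha) * ((1 + c) * C2) ^+ (d - 1) *
    (n%:R * (L * LL) ^+ (d - 1)).
  by rewrite mulr_ge0 // mulr_ge0 // exprn_ge0 // mulr_ge0; lra.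
case: TR hR => [tR|] hR; last by rewrite /links cardfs0.
case: TB hB => [tB|] hB; last by rewrite /links cardfs0.
apply: le_trans (card_links_le tR tB) _.
have [lambda nl lle] := expr_decay q0 q1 n1.
have lam0 : (0 < lambda)%N.
  by case: lambda nl {lle} => //; rewrite expr0 mulr1 ltNge n1.
have lam1 : 1 <= lambda%:R :> R by rewrite ler1n.
have lamR : 0 < lambda%:R :> R by rewrite ltr0n.
(* The crude factor of all [d] layers, hence large enough at every level of the recursion. *)
pose D : R := (lambda%:R ^+ 2) ^+ d.
have D1 : 1 <= D by rewrite !exprn_ege1.
have D0 : 0 < D by lra.
have y1 : 1 <= D ^+ 2 / alpha.
  rewrite ler_pdivlMr // mul1r; apply: le_trans (_ : 1 <= _); first lra.
  by rewrite exprn_ege1.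
have [k yk kle] := expr_decay q0 q1 y1.
have k0 : (0 < k)%N.
  by case: k yk {kle} => //; rewrite expr0 mulr1 ltNge y1.
have lleL : lambda%:R <= (1 + c) * L.
  apply: le_trans lle _; rewrite mulrDl mul1r lerD2r //.
have kleLL : k%:R <= C2 * LL.
  apply: le_trans kle _; rewrite -/c.
  have -> : ln (D ^+ 2 / alpha) = (4 * d)%:R * ln lambda%:R - ln alpha.
    rewrite ln_div ?posrE ?exprn_gt0 //.
    rewrite /D !lnXn ?exprn_gt0 //.
    by rewrite mulr_natl -!mulrnA mulnCA mulnC -mulnA.
  have lnl : ln lambda%:R <= (ln (1 + c) + 1) * LL.
    apply: (@le_trans _ _ (ln ((1 + c) * L))).
      by rewrite ler_ln ?posrE ?ltr0n // mulr_gt0 // ltr_wpDr.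
    rewrite lnM ?posrE ?ltr_wpDr // -/LL mulrDl mul1r lerD2r ler_peMr //.
  rewrite /C2 mulrDl mul1r lerD // -mulrA ler_wpM2l // mulrBl lerB //.
    by rewrite -mulrA ler_wpM2l.
  by rewrite ler_neMr.
have csd : size (enum 'I_d) = d by rewrite size_enum_ord.
have LR : layered alpha RR tR lambda.
  by split; rewrite ?cR //; first [exact: fset_uniq|rewrite -(ltr_nat R)].
have LB : layered alpha BB tB lambda.
  split=> //; first exact: fset_uniq.
    by apply: is_layers_size_gt0 hB; rewrite csd.
  apply: le_lt_trans nl; rewrite ler_wpM2r ?exprn_ge0 ?(ltW q0) //.
  by rewrite ler_nat -[size _]/(#|` BB|) cB.
have Dk : D ^+ 2 * (1 - alpha) ^+ k < alpha.
  by move: yk; rewrite mulrAC ltr_pdivrMr // mul1r.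
have := HK1 _ RR BB tR tB lambda k D (enum_uniq _).
rewrite csd => /(_ d1 lam0 k0 D0 (lexx _) Dk LR LB) /le_trans; apply.
rewrite -[size RR]/(#|` RR|) -[size BB]/(#|` BB|) cR cB.
have Kp : 0 <= K1 + d%:R * alpha^-1.
  by rewrite addr_ge0 // mulr_ge0 // invr_ge0 ltW.
(* The factor 2 comes from bounding [n + m] by [n + n]. *)
have -> : 2 * (K1 + d%:R / alpha) * ((1 + c) * C2) ^+ (d - 1) *
   (n%:R * (L * LL) ^+ (d - 1)) =
   (K1 + d%:R / alpha) * ((1 + c) * L * (C2 * LL)) ^+ (d - 1) * (n%:R + n%:R).
  by rewrite mulrACA !exprMn; ring.
apply: ler_pM.
- by rewrite mulr_ge0 // exprn_ge0.
- by rewrite addr_ge0.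
- rewrite ler_wpM2l // lerXn2r ?nnegrE //; last by rewrite natrM ler_pM.
  by rewrite !mulr_ge0 //; lra.
by rewrite lerD2l ler_nat.
Qed.
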